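(* Let $L$ be a finite-dimensional non-solvable Lie algebra over an algebraically closed field $F$ of characteristic different from $2,3$. Then every $2$-maximal subalgebra of $L$ is nilpotent if and only if $L/\phi(L)\cong sl(2)$ and $sl(2)$ acts nilpotently on $\phi(L)$. If these equivalent conditions hold and either $F$ has characteristic zero or $L$ is restricted, then $\phi(L)=0$.
   Context: A $2$-maximal subalgebra of $L$ is a subalgebra $S_0$ for which there is a chain $S_0<S_1<S_2=L$ of subalgebras with each $S_i$ a maximal subalgebra of $S_{i+1}$. $\phi(L)$ is the Frattini ideal of $L$: the largest ideal of $L$ contained in the intersection of all maximal subalgebras of $L$. $sl(2)$ is the Lie algebra of trace-zero $2\times 2$ matrices over $F$. ''$sl(2)$ acts nilpotently on $\phi(L)$'', where $sl(2)$ is identified with $L/\phi(L)$, means that for every $x\in L$ the restriction of $\mathrm{ad}\,x$ to $\phi(L)$ is nilpotent (since $\phi(L)$ is a nilpotent ideal acting trivially on the chief factors of $L$, this depends only on the coset $x+\phi(L)$). *)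

(* Defs.v *)
From HB Require Import structures.
From mathcomp Require Import all_boot all_order all_algebra.
From mathcomp Require Import boolp.
From mathcomp Require Import ring.

Set Implicit Arguments.
Unset Strict Implicit.
Unset Printing Implicit Defensive.

Import GRing.Theory.
Local Open Scope ring_scope.

HB.mixin Record Vector_isLieAlgebra (F : fieldType) L of Vector F L := {
  lie : L -> L -> L;
  lie_is_linearl : forall y, linear (lie^~ y);
  lie_is_linearr : forall x, linear (lie x);
  liexx : forall x, lie x x = 0;
  lie_jacobi : forall x y z,
    lie x (lie y z) + lie y (lie z x) + lie z (lie x y) = 0
}.

#[short(type="lieAlgType")]
HB.structure Definition LieAlgebra (F : fieldType) :=
  {L of Vector_isLieAlgebra F L & Vector F L}.

HB.instance Definition _ (F : fieldType) (L : lieAlgType F) (x : L) :=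
  GRing.isLinear.Build F L L _ (lie x) (lie_is_linearr x).

Section Basics.
Variables (F : fieldType) (L : lieAlgType F).
Implicit Types (x y z : L) (S T U V M : {vspace L}).

Lemma lieDl x y z : lie (x + y) z = lie x z + lie y z.
Proof. by have := lie_is_linearl z 1 x y; rewrite !scale1r. Qed.

Lemma lie0l z : lie 0 z = 0.
Proof. by apply: (addrI (lie 0 z)); rewrite -lieDl !addr0. Qed.

Lemma lie0r x : lie x 0 = 0.
Proof. exact: linear0. Qed.

Lemma lieZl a x z : lie (a *: x) z = a *: lie x z.
Proof. by have := lie_is_linearl z a x 0; rewrite lie0l !addr0. Qed.

Lemma lieNl x z : lie (- x) z = - lie x z.
Proof. by rewrite -scaleN1r lieZl scaleN1r. Qed.

Lemma lieC x y : lie x y = - lie y x.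
Proof.
apply/eqP; rewrite -addr_eq0; have := liexx (x + y).
by rewrite lieDl !linearD /= !liexx add0r addr0 => ->.
Qed.

Definition is_subalgebra S :=
  forall x y, x \in S -> y \in S -> lie x y \in S.

Definition is_ideal S := forall x y, y \in S -> lie x y \in S.

Definition is_maximal_subalgebra M T :=
  [/\ is_subalgebra M, (M <= T)%VS, M <> T &
      forall U, is_subalgebra U -> (M <= U)%VS -> (U <= T)%VS ->
        U = M \/ U = T].

Definition is_2maximal_subalgebra S :=
  exists2 S1, is_maximal_subalgebra S S1 & is_maximal_subalgebra S1 fullv.

Definition liev U V : {vspace L} := <<allpairs lie (vbasis U) (vbasis V)>>%VS.

Lemma memv_lie U V x y : x \in U -> y \in V -> lie x y \in liev U V.
Proof.
move=> /coord_vbasis-> /coord_vbasis->.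
rewrite linear_sum; apply: memv_suml => j _; rewrite linearZ memvZ //=.
elim/big_rec: _ => [|i z _ IHz]; first by rewrite lie0l mem0v.
rewrite lieDl memvD // lieZl memvZ // memv_span //.
by apply/allpairsP; exists ((vbasis U)`_i, (vbasis V)`_j);
   rewrite !mem_nth ?size_tuple.
Qed.

Lemma lievP U V (W : {vspace L}) :
  reflect (forall x y, x \in U -> y \in V -> lie x y \in W) (liev U V <= W)%VS.
Proof.
apply: (iffP idP) => [sW x y Ux Vy | sW].
  by apply: (subvP sW); apply: memv_lie.
by apply/span_subvP=> _ /allpairsP[[x y] /= [Ux Vy ->]];
   apply: sW; apply: vbasis_mem.
Qed.

Definition derived_series n : {vspace L} := iter n (fun U => liev U U) fullv.

Definition lower_central_series S n : {vspace L} := iter n (liev S) S.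

Definition nilpotent_subalgebra S :=
  exists n, lower_central_series S n = 0%VS.

Definition in_all_maximal U :=
  forall M, is_maximal_subalgebra M fullv -> (U <= M)%VS.

Lemma frattini_exists :
  exists P, [/\ is_ideal P, in_all_maximal P &
    forall J, is_ideal J -> in_all_maximal J -> (J <= P)%VS].
Proof.
suff H n U : is_ideal U -> in_all_maximal U -> (\dim {:L} - \dim U <= n)%N ->
    exists P, [/\ is_ideal P, in_all_maximal P &
      forall J, is_ideal J -> in_all_maximal J -> (J <= P)%VS].
  apply: (H (\dim {:L}) 0%VS); last exact: leq_subr.
    by move=> x y; rewrite !memv0 => /eqP->; rewrite linear0.
  by move=> M _; apply: sub0v.
elim: n U => [|n IHn] U idU mU leU.
  exists U; split=> // J _ _.
  have /eqP-> : U == fullv by rewrite eqEdim subvf /= -subn_eq0 -leqn0.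
  exact: subvf.
have [maxU|/existsNP[J /not_implyP[idJ /not_implyP[mJ /negP nJU]]]] :=
  pselect (forall J, is_ideal J -> in_all_maximal J -> (J <= U)%VS).
  by exists U.
apply: (IHn (U + J)%VS).
- move=> x _ /memv_addP[u uU [v vJ ->]]; rewrite linearD /=.
  by rewrite memv_add ?idU ?idJ.
- by move=> M maxM; rewrite subv_add mU ?mJ.
have ltU : (\dim U < \dim (U + J))%N.
  rewrite ltn_neqAle dimvS ?addvSl // andbT; apply: contra nJU => eqd.
  have /eqP-> : U == (U + J)%VS by rewrite eqEdim addvSl -(eqP eqd) leqnn.
  exact: addvSr.
rewrite -ltnS; apply: leq_trans leU; apply: ltn_sub2l => //.
by apply: leq_trans ltU _; apply/dimvS/subvf.
Qed.

Definition frattini : {vspace L} := projT1 (cid frattini_exists).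

Lemma frattiniP :
  [/\ is_ideal frattini, in_all_maximal frattini &
      forall J, is_ideal J -> in_all_maximal J -> (J <= frattini)%VS].
Proof. by rewrite /frattini; case: cid. Qed.

Lemma frattini_ideal : is_ideal frattini.
Proof. by case: frattiniP. Qed.

Definition acts_nilpotently V :=
  forall x, exists n, forall v, v \in V -> iter n (lie x) v = 0.

(* [ad_coef x y n k] is the coefficient of t^k in (ad (t x + y))^n x, computed
   in L[t]; see [ad_coefE]. *)
Fixpoint ad_coef x y n k : L :=
  if n is m.+1 then
    lie y (ad_coef x y m k) + (if k is l.+1 then lie x (ad_coef x y m l) else 0)
  else if k == 0%N then x else 0.

Lemma ad_coef_eq0 x y n k : (n < k)%N -> ad_coef x y n k = 0.
Proof.
elim: n k => [|n IHn] [|k] //= ltnk.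
by rewrite (IHn k.+1 (ltnW ltnk)) (IHn k ltnk) !lie0r addr0.
Qed.

Lemma ad_coefE x y n (t : F) :
  iter n (lie (t *: x + y)) x = \sum_(k < n.+1) t ^+ k *: ad_coef x y n k.
Proof.
elim: n => [|n IHn]; first by rewrite big_ord1 expr0 scale1r.
rewrite iterS {}IHn lieDl lieZl.
transitivity (\sum_(k < n.+2) t ^+ k *: lie y (ad_coef x y n k) +
    \sum_(k < n.+1) t ^+ k.+1 *: lie x (ad_coef x y n k)).
  rewrite addrC; congr (_ + _).
    rewrite [RHS]big_ord_recr /= ad_coef_eq0 // lie0r scaler0 addr0.
    by rewrite linear_sum; apply: eq_bigr => k _; rewrite linearZ.
  rewrite linear_sum scaler_sumr; apply: eq_bigr => k _.
  by rewrite linearZ scalerA exprS.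
under [RHS]eq_bigr do rewrite /= scalerDr.
rewrite big_split /=; congr (_ + _).
by rewrite [RHS]big_ord_recl /= scaler0 add0r.
Qed.

(* Jacobson's s_i, 0 < i < p: i * s_i(x, y) is the coefficient of t^(i-1) in
   (ad (t x + y))^(p-1) x. *)
Definition jacobson_s p i x y : L := i%:R^-1 *: ad_coef x y p.-1 i.-1.

Definition is_pmap p (f : L -> L) :=
  [/\ forall (a : F) x, f (a *: x) = a ^+ p *: f x,
      forall x y, lie (f x) y = iter p (lie x) y &
      forall x y,
        f (x + y) = f x + f y + \sum_(1 <= i < p) jacobson_s p i x y].

End Basics.

Definition solvable (F : fieldType) (L : lieAlgType F) :=
  exists n, derived_series L n = 0%VS.

Definition restricted (F : fieldType) (L : lieAlgType F) :=
  exists2 p, p \in [pchar F] & exists f : L -> L, is_pmap p f.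

Definition lie_isomorphic (F : fieldType) (L M : lieAlgType F) :=
  exists f : {linear L -> M},
    bijective f /\ forall x y, f (lie x y) = lie (f x) (f y).

(* The quotient L / I is carried by the complement I^C of I, with the bracket
   of L projected to I^C along I; [quot_proj_onto], [quot_proj_eq0] and
   [quot_proj_lie] characterise it. *)
Definition quot_lie (F : fieldType) (L : lieAlgType F) (I : {vspace L})
  (idI : is_ideal I) := subvs_of (I^C)%VS.

Section Quotient.
Variables (F : fieldType) (L : lieAlgType F) (I : {vspace L}).
Variable idI : is_ideal I.
Local Notation Q := (quot_lie idI).

HB.instance Definition _ := Vector.on Q.

Definition quot_proj (x : L) : Q := vsproj (I^C)%VS (daddv_pi (I^C)%VS I x).
Definition quot_repr (u : Q) : L := vsval u.

Fact quot_proj_is_linear : linear quot_proj.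
Proof. by move=> a x y; rewrite /quot_proj !linearP. Qed.
HB.instance Definition _ :=
  GRing.isLinear.Build F L Q _ quot_proj quot_proj_is_linear.

Fact quot_repr_is_linear : linear quot_repr.
Proof. by move=> a x y; rewrite /quot_repr linearP. Qed.
HB.instance Definition _ :=
  GRing.isLinear.Build F Q L _ quot_repr quot_repr_is_linear.

Lemma quot_reprK : cancel quot_repr quot_proj.
Proof.
move=> u; rewrite /quot_proj daddv_pi_id ?subvsP ?vsvalK //.
by rewrite capvC capv_compl.
Qed.

Lemma quot_proj_onto (u : Q) : exists x, quot_proj x = u.
Proof. by exists (quot_repr u); rewrite quot_reprK. Qed.

Lemma quot_proj_eq0 (x : L) : (quot_proj x == 0) = (x \in I).
Proof.
have capI : (I^C :&: I = 0)%VS by rewrite capvC capv_compl.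
have addI : x \in (I^C + I)%VS by rewrite addvC addv_complf memvf.
have defx := daddv_pi_add capI addI.
apply/eqP/idP => [x0 | Ix].
  rewrite -defx.
  have -> : daddv_pi (I^C)%VS I x = 0.
    rewrite -[LHS](@vsprojK _ _ (I^C)%VS) ?memv_pi //.
    by rewrite -/(quot_proj x) x0 linear0.
  by rewrite add0r memv_pi.
rewrite /quot_proj; have <- : x - daddv_pi I (I^C)%VS x = daddv_pi (I^C)%VS I x.
  by rewrite -{1}defx addrK.
by rewrite daddv_pi_id ?capv_compl // subrr linear0.
Qed.

Lemma quot_reprKI (x : L) : quot_repr (quot_proj x) - x \in I.
Proof. by rewrite -quot_proj_eq0 linearB /= quot_reprK subrr. Qed.

Lemma eq_quot_proj (x y : L) : x - y \in I -> quot_proj x = quot_proj y.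
Proof. by rewrite -quot_proj_eq0 linearB subr_eq0 => /eqP. Qed.

Definition quot_bracket (u v : Q) : Q :=
  quot_proj (lie (quot_repr u) (quot_repr v)).

Lemma quot_proj_bracket (x y : L) :
  quot_proj (lie x y) = quot_bracket (quot_proj x) (quot_proj y).
Proof.
apply/esym/eq_quot_proj; have Ix := quot_reprKI x; have Iy := quot_reprKI y.
set x' := quot_repr _ in Ix *; set y' := quot_repr _ in Iy *.
have -> : lie x' y' - lie x y = lie x' (y' - y) + lie (x' - x) y.
  by rewrite linearB lieDl lieNl addrA subrK.
by apply: memvD; [exact: idI | rewrite lieC memvN; apply: idI].
Qed.

Fact quot_bracket_linearl v : linear (quot_bracket^~ v).
Proof.
by move=> a u w; rewrite /quot_bracket [quot_repr _]linearP /= lieDl lieZl linearP.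
Qed.

Fact quot_bracket_linearr u : linear (quot_bracket u).
Proof. by move=> a v w; rewrite /quot_bracket !linearP. Qed.

Fact quot_bracketxx u : quot_bracket u u = 0.
Proof. by rewrite /quot_bracket liexx linear0. Qed.

Fact quot_bracket_jacobi u v w :
  quot_bracket u (quot_bracket v w) + quot_bracket v (quot_bracket w u) +
  quot_bracket w (quot_bracket u v) = 0.
Proof.
rewrite -[u]quot_reprK -[v]quot_reprK -[w]quot_reprK -!quot_proj_bracket.
by rewrite -!linearD lie_jacobi linear0.
Qed.

HB.instance Definition _ := Vector_isLieAlgebra.Build F Q
  quot_bracket_linearl quot_bracket_linearr quot_bracketxx quot_bracket_jacobi.

Lemma quot_proj_lie (x y : L) :
  quot_proj (lie x y) = lie (quot_proj x) (quot_proj y).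
Proof. exact: quot_proj_bracket. Qed.

End Quotient.

Definition sl2 (F : fieldType) :=
  subvs_of (lker (linfun (@mxtrace F 2 : 'M[F]_2 -> F^o))).

Section SL2.
Variable F : fieldType.
Local Notation sl := (lker (linfun (@mxtrace F 2 : 'M[F]_2 -> F^o))).

HB.instance Definition _ := Vector.on (sl2 F).

Lemma mem_sl2 (A : 'M[F]_2) : (A \in sl) = (\tr A == 0).
Proof. by rewrite memv_ker lfunE. Qed.

Definition mx_commutator (A B : 'M[F]_2) := A *m B - B *m A.

Fact mx_commutator_sl2 A B : mx_commutator A B \in sl.
Proof. by rewrite mem_sl2 linearB /= mxtrace_mulC subrr. Qed.

Definition sl2_mx (A : sl2 F) : 'M[F]_2 := vsval A.

Fact sl2_mx_is_linear : linear sl2_mx.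
Proof. by move=> a A B; rewrite /sl2_mx linearP. Qed.
HB.instance Definition _ :=
  GRing.isLinear.Build F (sl2 F) 'M[F]_2 _ sl2_mx sl2_mx_is_linear.

Lemma sl2_mx_inj : injective sl2_mx.
Proof. exact: val_inj. Qed.

Definition sl2_bracket (A B : sl2 F) : sl2 F :=
  Subvs (mx_commutator_sl2 (sl2_mx A) (sl2_mx B)).

Lemma sl2_mx_bracket A B :
  sl2_mx (sl2_bracket A B) = sl2_mx A *m sl2_mx B - sl2_mx B *m sl2_mx A.
Proof. by []. Qed.

Fact sl2_bracket_linearl B : linear (sl2_bracket^~ B).
Proof.
move=> a A C; apply: sl2_mx_inj; rewrite [RHS]linearP /= /mx_commutator /sl2_mx.
rewrite mulmxDl mulmxDr -scalemxAl -scalemxAr.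
by rewrite scalerBr opprD addrACA.
Qed.

Fact sl2_bracket_linearr A : linear (sl2_bracket A).
Proof.
move=> a B C; apply: sl2_mx_inj; rewrite [RHS]linearP /= /mx_commutator /sl2_mx.
rewrite mulmxDl mulmxDr -scalemxAl -scalemxAr.
by rewrite scalerBr opprD addrACA.
Qed.

Fact sl2_bracketxx A : sl2_bracket A A = 0.
Proof.
by apply: sl2_mx_inj; rewrite sl2_mx_bracket subrr linear0.
Qed.

Fact sl2_bracket_jacobi A B C :
  sl2_bracket A (sl2_bracket B C) + sl2_bracket B (sl2_bracket C A) +
  sl2_bracket C (sl2_bracket A B) = 0.
Proof.
apply: sl2_mx_inj; rewrite !linearD linear0 /= /mx_commutator /sl2_mx /=.
rewrite !mulmxBr !mulmxBl !mulmxA; apply/matrixP => i j; rewrite !mxE.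
by ring.
Qed.

HB.instance Definition _ := Vector_isLieAlgebra.Build F (sl2 F)
  sl2_bracket_linearl sl2_bracket_linearr sl2_bracketxx sl2_bracket_jacobi.

End SL2.

(* Main.v *)
From HB Require Import structures.
Require Import Defs.
From mathcomp Require Import all_boot all_order all_algebra.
From mathcomp Require Import boolp ring.

Set Implicit Arguments.
Unset Strict Implicit.
Unset Printing Implicit Defensive.

Import GRing.Theory passmx.
Local Open Scope ring_scope.

(**
The Frattini ideal vanishes under either condition.

If [L / phi] is [sl2] and [L] acts nilpotently on [phi], let [x] lift [h]. As [ad x] is nilpotent
on [phi], [e] and [f] lift to true weight vectors of [ad x], and these generate a
three-dimensional complement of [phi]. A complement of the Frattini ideal is all of [L], so
[phi = 0] and [dim L = 3], whence 2-maximal subalgebras have dimension at most one.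

Conversely, a non-nilpotent subalgebra contains [x, y <> 0] with [[x, y] = a y] and [a <> 0], by
Engel's theorem. If all 2-maximal subalgebras are nilpotent, each such [B = <x> + <y>] is a
maximal subalgebra of [L]. Fix [x]. If some such [y] is ad-nilpotent, then [ad x] has an
eigenvector [z + B] in the kernel of [ad y] on [L / B], so that [L = B + <z>], and a non-solvable
algebra of this form is [sl2]. Otherwise the Fitting null component of [ad y] is [B], so [ad y]
is invertible on [L / B] and conjugates [ad x] there to [ad x + a]. Comparing the traces of
[ad x] and of its square gives [tr (ad x | L / B) = 0], since the characteristic is not 2, so every
nonzero eigenvalue of [ad x] on [L] equals its trace. But the spectrum on [L / B] contains
[l, l + a, l + 2 a] for some [l], and these cannot all lie in [{0, a}].
*)

(** * Linear algebra: maximal subspaces, iterates and coordinates *)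

Section VectorSpaces.
Variables (F : fieldType) (V : vectType F).
Implicit Types (P : {vspace V} -> Prop) (U W : {vspace V}) (u v w : V).

(** Finite dimension stands in for Zorn's lemma: induction on the codimension of [U]. *)
Lemma exists_max_vspace P U :
  P U -> exists W, [/\ P W, (U <= W)%VS & forall W', P W' -> (W <= W')%VS -> W' = W].
Proof.
have [n] := ubnP (\dim {:V} - \dim U)%N.
elim: n U => // n IHn U ltUn PU.
have [maxU | /existsNP[W /not_implyP[PW /not_implyP[sUW neWU]]]] :=
  pselect (forall W, P W -> (U <= W)%VS -> W = U).
  by exists U.
have ltUW : (\dim U < \dim W)%N.
  rewrite ltn_neqAle dimvS // andbT; apply: contra_notN neWU => eqd.
  by apply/esym/eqP; rewrite eqEdim sUW (eqP eqd) leqnn.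
have [|W' [PW' sWW' maxW']] := IHn W _ PW.
  rewrite -ltnS (leq_trans _ ltUn) // ltnS ltn_sub2l //.
  by apply: leq_trans ltUW _; apply/dimvS/subvf.
by exists W'; split=> //; apply: subv_trans sWW'.
Qed.

(** A maximal subspace inside [Q] is all of [Q], since adjoining a line spanned by a vector of [Q]
    stays inside [Q]. *)
Lemma exists_vspace_of (Q : V -> Prop) :
  Q 0 -> (forall a u v, Q u -> Q v -> Q (a *: u + v)) ->
  exists U, forall v, v \in U <-> Q v.
Proof.
move=> Q0 Qlin; pose P U := forall v, v \in U -> Q v.
have [|U [PU _ maxU]] := @exists_max_vspace P 0%VS.
  by move=> v; rewrite memv0 => /eqP->.
exists U => v; split=> [/PU // | Qv].
rewrite -(maxU (U + <[v]>)%VS) ?addvSl ?(subvP (addvSr _ _)) ?memv_line //.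
move=> _ /memv_addP[u Uu [_ /vlineP[a ->] ->]].
by rewrite addrC; apply: Qlin => //; apply: PU.
Qed.

Lemma mem_line2P u w v :
  reflect (exists p q, v = p *: u + q *: w) (v \in (<[u]> + <[w]>)%VS).
Proof.
apply: (iffP memv_addP) => [[_ /vlineP[p ->] [_ /vlineP[q ->] ->]]|[p [q ->]]].
  by exists p, q.
by exists (p *: u); rewrite ?memvZ ?memv_line //; exists (q *: w); rewrite ?memvZ ?memv_line.
Qed.

Lemma iter_linear (f : {linear V -> V}) n : linear (iter n f).
Proof. by elim: n => // n IHn a u v; rewrite !iterS IHn linearP. Qed.

Lemma iter_eigen (f : {linear V -> V}) a v n : f v = a *: v -> iter n f v = a ^+ n *: v.
Proof.
move=> fv; elim: n => [|n IHn]; first by rewrite scale1r.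
by rewrite iterS IHn linearZ /= fv scalerA exprSr.
Qed.

Lemma iter_eq0_le (f : {linear V -> V}) m n v :
  (m <= n)%N -> iter m f v = 0 -> iter n f v = 0.
Proof.
move=> /subnK <-; rewrite iterD => ->.
by elim: (n - m)%N => // k IHk; rewrite iterS IHk linear0.
Qed.

(** Matrices act on row vectors from the right, so [mx_of f *m mx_of g] represents [f] followed by
    [g]. *)
Definition mx_of (f : {linear V -> V}) := mxof (vbasis {:V}) (vbasis {:V}) (linfun f).

Definition row_of (v : V) := rVof (vbasis {:V}) v.

Lemma row_of_inj : injective row_of.
Proof. exact: can_inj (rVofK (vbasisP fullv)). Qed.

Lemma row_of_onto r : exists v, row_of v = r.
Proof. by exists (vecof (vbasis {:V}) r); apply: (vecofK (vbasisP fullv)). Qed.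

Lemma row_ofP a u v : row_of (a *: u + v) = a *: row_of u + row_of v.
Proof. exact: rVof_linear. Qed.

Lemma row_of_mul (f : {linear V -> V}) v : row_of v *m mx_of f = row_of (f v).
Proof. by rewrite -rVof_app ?vbasisP // lfunE. Qed.

End VectorSpaces.

(** * Eigenvectors over an algebraically closed field *)

Section ClosedField.
Variable F : closedFieldType.

(* Cayley-Hamilton, with the characteristic polynomial split into factors. *)
Lemma mx_split_annihilator n (A : 'M[F]_n) :
  exists s : seq F, forall v : 'rV_n, foldr (fun a w => w *m A - a *: w) v s = 0.
Proof.
case: n A => [|n] A; first by exists [::] => v; apply/rowP => -[].
have [s defs] := closed_field_poly_normal (char_poly A).
exists s => v.
have fE t : foldr (fun a w => w *m A - a *: w) v t =
    v *m horner_mx A (\prod_(z <- t) ('X - z%:P)).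
  elim: t => [|a t IHt] /=; first by rewrite big_nil rmorph1 mulmx1.
  rewrite big_cons mulrC rmorphM rmorphB /= horner_mx_X horner_mx_C IHt.
  by rewrite -mulmxE mulmxA mulmxBr mul_mx_scalar.
rewrite fE; move: defs; rewrite (monicP (char_poly_monic A)) scale1r => <-.
by rewrite Cayley_Hamilton mulmx0.
Qed.

Lemma split_annihilator (V : vectType F) (f : {linear V -> V}) :
  exists s : seq F, forall v, foldr (fun a w => f w - a *: w) v s = 0.
Proof.
have [s sP] := mx_split_annihilator (mx_of f).
exists s => v; apply: row_of_inj; rewrite /row_of linear0 -(sP (row_of v)).
elim: s {sP} => //= a s <-; rewrite -/(row_of _) addrC -scaleNr row_ofP.
by rewrite row_of_mul scaleNr addrC.
Qed.

(** Applying the factors of an annihilating polynomial one by one leads from [v], outside [U], to 0,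
    inside [U]; the vector [w] is a partial result that the next factor sends into [U]. Only [U 0]
    is asked of [U], so it need not be stable under [f]. *)
Lemma exists_eigen_mod (V : vectType F) (f : {linear V -> V}) (K U : V -> Prop) v :
  (forall a w, K w -> K (f w - a *: w)) -> U 0 -> K v -> ~ U v ->
  exists a w, [/\ K w, ~ U w & U (f w - a *: w)].
Proof.
move=> Kf U0 Kv nUv; have [s sP] := split_annihilator f.
have: U (foldr (fun a w => f w - a *: w) v s) by rewrite sP.
elim: s {sP} => //= a s IHs Ua.
have [/IHs // | nU] := pselect (U (foldr (fun a w => f w - a *: w) v s)).
exists a, (foldr (fun a w => f w - a *: w) v s); split=> //.
by elim: s {IHs Ua nU} => //= b s IHs; apply: Kf.
Qed.

End ClosedField.

(** * A trace identity for conjugation by an invertible weight operator *)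

Section Trace.
Variable F : fieldType.

(* The matrices act on the quotient of the row space by [b]; if [Y] is
   invertible there, then [X] is conjugate to [X + a] on the quotient, which
   forces the dimension and then the trace of [X] there to vanish in [F]. *)
Lemma mxtrace_weight n m (X Y : 'M[F]_n) (b : 'M_(m, n)) (D : 'M_m) (a : F) :
  2%:R != 0 :> F -> a != 0 -> row_free b -> b *m X = D *m b -> (b *m Y <= b)%MS ->
  (forall v : 'rV_n, (v *m Y <= b)%MS -> (v <= b)%MS) ->
  Y *m X = X *m Y + a *: Y -> \tr X = \tr D.
Proof.
move=> char2 a0 freeb bX bY invY YX.
(* [c] is the projection onto the quotient by the row space of [b], and [c'] is a section of it. *)
have [r [c [c' [c'c bc subc]]]] : exists r (c : 'M[F]_(n, r)) (c' : 'M_(r, n)),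
    [/\ c' *m c = 1%:M, b *m c = 0 &
      forall k (w : 'M_(k, n)), w *m c = 0 -> (w <= b)%MS].
  have fullc : row_full (col_base (cokermx b)) by apply: col_base_full.
  have defc := mulmx_base (cokermx b).
  exists _, (col_base (cokermx b)), (pinvmx (col_base (cokermx b))); split.
  - by rewrite mulVpmx.
  - have: b *m cokermx b = 0 by apply/eqP; rewrite -submxE.
    rewrite -{1}defc mulmxA => /(congr1 (mulmx^~ (pinvmx (row_base (cokermx b))))).
    by rewrite mul0mx -mulmxA mulmxVp ?mulmx1 ?row_base_free.
  - by move=> k w wc; rewrite submxE -defc mulmxA wc mul0mx.
(* A matrix preserving [b] descends to the quotient as [c' *m Z *m c], because the rows of
   [1 - c *m c'] lie in [b]. *)
have quotE (Z : 'M[F]_n) : (b *m Z <= b)%MS -> Z *m c = c *m (c' *m Z *m c).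
  move=> /submxP[e be]; apply/eqP; rewrite -subr_eq0 !mulmxA -mulmxBl.
  rewrite -[X in X - _]mul1mx -mulmxBl.
  have /subc/submxP[d ->] : (1%:M - c *m c') *m c = 0.
    by rewrite mulmxBl mul1mx -mulmxA c'c mulmx1 subrr.
  by rewrite -!mulmxA [b *m (Z *m c)]mulmxA be -mulmxA bc !mulmx0.
set X' := c' *m X *m c; set Y' := c' *m Y *m c.
have Xc : X *m c = c *m X' by apply: quotE; rewrite bX submxMl.
have Yc : Y *m c = c *m Y' by apply: quotE.
clearbody X' Y'.
have unitY : Y' \in unitmx.
  rewrite -row_free_unit -kermx_eq0; apply/eqP/row_matrixP => i; rewrite row0.
  set w := row i _; have wY : w *m Y' = 0.
    by apply/sub_kermxP; apply: row_sub.
  have: (w *m c' *m Y <= b)%MS.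
    by apply: subc; rewrite -mulmxA Yc !mulmxA -[w *m c' *m c]mulmxA c'c mulmx1 wY.
  move/invY/submxP => [d wd]; rewrite -[w]mulmx1 -c'c mulmxA wd.
  by rewrite -mulmxA bc mulmx0.
have YX' : Y' *m X' = X' *m Y' + a *: Y'.
  rewrite -[LHS]mul1mx -[RHS]mul1mx -c'c -!mulmxA; congr (_ *m _).
  rewrite mulmxDr -scalemxAr !mulmxA -Yc -Xc -[Y *m c *m X']mulmxA -Xc.
  by rewrite -[X *m c *m Y']mulmxA -Yc !mulmxA YX mulmxDl scalemxAl.
set Z := X' + a%:M.
have defZ : Z = Y' *m X' *m invmx Y'.
  by rewrite YX' -[a *: Y']mul_scalar_mx -mulmxDl mulmxK.
have trZ : \tr Z = \tr X' by rewrite defZ mxtrace_mulC mulmxA mulVmx // mul1mx.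
have trZZ : \tr (Z *m Z) = \tr (X' *m X').
  by rewrite defZ !mulmxA mulmxKV // mxtrace_mulC !mulmxA mulVmx // mul1mx.
have tra0 : \tr (a%:M : 'M_r) = 0.
  by apply: (addrI (\tr X')); rewrite -mxtraceD addr0.
(* Expanding the trace of the square of [Z], the term in the square of [a] vanishes by [tra0],
   leaving [2 a \tr X' = 0]. *)
have trX'0 : \tr X' = 0.
  have trXa : \tr (X' *m a%:M) = a * \tr X' by rewrite mul_mx_scalar mxtraceZ.
  have traX : \tr (a%:M *m X') = a * \tr X' by rewrite mul_scalar_mx mxtraceZ.
  have traa : \tr (a%:M *m a%:M : 'M_r) = 0 by rewrite mul_scalar_mx mxtraceZ tra0 mulr0.
  move: trZZ; rewrite mulmxDl !mulmxDr !mxtraceD trXa traX traa addr0 -addrA -mulr2n.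
  move=> /(canRL (addKr _))/eqP; rewrite addNr -mulrnAr mulf_eq0 (negPf a0) -mulr_natr.
  by rewrite mulf_eq0 (negPf char2) orbF => /eqP.
have /subc/submxP[d defd] : (1%:M - c *m c') *m c = 0.
  by rewrite mulmxBl mul1mx -mulmxA c'c mulmx1 subrr.
have bd : b *m d = 1%:M.
  apply: (row_free_inj freeb); rewrite mul1mx -mulmxA -defd mulmxBr mulmx1 mulmxA.
  by rewrite bc mul0mx subr0.
(* This splits [X] into its parts on the quotient and on [b], with traces [\tr X'] and [\tr D]. *)
have defX : X = c *m c' *m X + d *m D *m b.
  by rewrite -[d *m D *m b]mulmxA -bX [d *m _]mulmxA -defd -mulmxDl addrC subrK mul1mx.
have trX'E : \tr (c *m c' *m X) = 0 by rewrite -mulmxA mxtrace_mulC -mulmxA Xc mulmxA c'c mul1mx.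
by rewrite defX mxtraceD trX'E add0r mxtrace_mulC mulmxA bd mul1mx.
Qed.

End Trace.

(** * Engel's theorem and Fitting null components *)

Section LieAlgebras.
Variables (F : fieldType) (L : lieAlgType F).
Implicit Types (x y z u v w : L) (S T U V W M : {vspace L}).

Lemma lie_derivation x y z : lie x (lie y z) = lie (lie x y) z + lie y (lie x z).
Proof.
have := lie_jacobi x y z; rewrite (lieC z (lie x y)) (lieC z x) linearN.
move=> /eqP; rewrite addrAC subr_eq0 => /eqP/(canRL (subrK _)) ->.
by rewrite addrC.
Qed.

Lemma lie_weight x u v a b :
  lie x u = a *: u -> lie x v = b *: v -> lie x (lie u v) = (a + b) *: lie u v.
Proof.
by move=> xu xv; rewrite lie_derivation xu xv lieZl linearZ -scalerDl.
Qed.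

Lemma subalgebraDline T z : is_subalgebra T ->
  (forall t, t \in T -> lie t z \in (T + <[z]>)%VS) -> is_subalgebra (T + <[z]>)%VS.
Proof.
move=> subT Tz _ _ /memv_addP[t Tt [_ /vlineP[a ->] ->]] /memv_addP[u Tu [_ /vlineP[b ->] ->]].
rewrite lieDl !linearD /= !lieZl !linearZ /= liexx !scaler0 addr0.
apply: memvD; first by rewrite memvD ?memvZ ?Tz // (subvP (addvSl _ _)) ?subT.
by rewrite lieC memvZ // memvN Tz.
Qed.

Lemma lievS U U' V V' : (U <= U')%VS -> (V <= V')%VS -> (liev U V <= liev U' V')%VS.
Proof.
move=> sU sV; apply/lievP => x y /(subvP sU) Ux /(subvP sV) Vy.
exact: memv_lie.
Qed.

Lemma derived_series_le_lower_central n :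
  (derived_series L n <= lower_central_series fullv n)%VS.
Proof. by elim: n => //= n IHn; apply: lievS => //; apply: subvf. Qed.

Lemma exists_maximal_subalgebra S T :
  is_subalgebra S -> (S <= T)%VS -> S <> T ->
  exists2 M, is_maximal_subalgebra M T & (S <= M)%VS.
Proof.
move=> subS sST neST; pose P U := [/\ is_subalgebra U, (U <= T)%VS & U <> T].
have [M [[subM sMT neMT] sSM maxM]] := @exists_max_vspace F L P S (And3 subS sST neST).
exists M => //; split=> // U subU sMU sUT; have [->|neUT] := pselect (U = T).
  by right.
by left; apply: maxM.
Qed.

(** Engel's lemma for the action of [S] on [V / U], by induction on the dimension of [S]: write [S]
    as a maximal subalgebra [T] plus a line normalising [T]. *)
Lemma exists_common_kernel M S U V :
  is_subalgebra M -> is_subalgebra S -> (S <= M)%VS ->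
  (forall x v, x \in M -> v \in M -> exists n, iter n (lie x) v = 0) ->
  (V <= M)%VS -> (U <= V)%VS -> U <> V ->
  (forall s v, s \in S -> v \in V -> lie s v \in V) ->
  (forall s u, s \in S -> u \in U -> lie s u \in U) ->
  exists2 v, v \in V /\ v \notin U & forall s, s \in S -> lie s v \in U.
Proof.
move=> subM + + nilM; have [n] := ubnP (\dim S).
elim: n S U V => // n IHn S U V leSn subS sSM sVM sUV neUV SV SU.
have [S0|neS] := pselect (0%VS = S).
  have /subvPn[v Vv nUv] : ~~ (V <= U)%VS.
    by apply/negP => sVU; apply: neUV; apply/eqP; rewrite eqEsubv sUV.
  by exists v => // s; rewrite -S0 memv0 => /eqP->; rewrite lie0l mem0v.
have [|T [subT sTS neTS maxT] _] := exists_maximal_subalgebra _ (sub0v S) neS.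
  by move=> x y; rewrite !memv0 => /eqP-> /eqP->; rewrite lie0l.
have ltTn : (\dim T < n)%N.
  rewrite -ltnS (leq_trans _ leSn) // ltnS ltn_neqAle dimvS // andbT.
  by apply: contra_notN neTS => dTS; apply/eqP; rewrite eqEdim sTS (eqP dTS) leqnn.
have sTM := subv_trans sTS sSM.
(* The induction hypothesis for [T] acting on [S / T] provides [z]. *)
have [z [Sz nTz] Tz] : exists2 z, z \in S /\ z \notin T & forall t, t \in T -> lie t z \in T.
  by apply: (IHn T T S) => // s v /(subvP sTS) ? ?; apply: subS.
have defS : S = (T + <[z]>)%VS.
  case: (maxT (T + <[z]>)%VS) => //.
  - by apply: subalgebraDline => // t /Tz; apply/subvP/addvSl.
  - exact: addvSl.
  - by rewrite subv_add sTS -memvE.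
  by move=> TzT; move: nTz; rewrite -TzT (subvP (addvSr _ _)) ?memv_line.
have [v [Vv nUv] Tv] : exists2 v, v \in V /\ v \notin U & forall t, t \in T -> lie t v \in U.
  by apply: (IHn T U V) => // s v /(subvP sTS) ? ?; [apply: SV | apply: SU].
have Mz := subvP sSM _ Sz.
have [m] := nilM z v Mz (subvP sVM _ Vv).
(* As [z] normalises [T], the vectors that [T] sends into [U] are stable under [ad z]; apply [ad z]
   until the next application would land in [U]. *)
elim: m v Vv nUv Tv => [|m IHm] v Vv nUv Tv.
  by move=> /= v0; rewrite v0 mem0v in nUv.
rewrite iterSr; have [Uzv _|nUzv] := boolP (lie z v \in U); last first.
  apply: IHm => //; first exact: SV.
  move=> t Tt; rewrite lie_derivation memvD //; first by apply/Tv/Tz.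
  exact/SU/Tv.
exists v => // s; rewrite defS => /memv_addP[t Tt [_ /vlineP[a ->] ->]].
by rewrite lieDl lieZl memvD ?(Tv t) ?memvZ.
Qed.

(** Take [U] maximal among the [M]-stable subspaces of [M] killed by iterated bracketing with [M].
    If [U] is not [M], some [v] outside [U] has all its brackets with [M] in [U], and [U + <[v]>]
    contradicts maximality. *)
Theorem engel M : is_subalgebra M ->
  (forall x v, x \in M -> v \in M -> exists n, iter n (lie x) v = 0) ->
  nilpotent_subalgebra M.
Proof.
move=> subM nilM.
pose P U := [/\ (U <= M)%VS, (forall x u, x \in M -> u \in U -> lie x u \in U) &
  exists n, iter n (liev M) U = 0%VS].
have [|U [[sUM MU [n Un]] _ maxU]] := @exists_max_vspace F L P 0%VS.
  split; [exact: sub0v | | by exists 0%N].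
  by move=> x u _; rewrite !memv0 => /eqP->; rewrite lie0r.
have [UM|neUM] := pselect (U = M); first by exists n; rewrite -UM in Un *.
have [v [Mv nUv] Mv_U] := exists_common_kernel subM subM (subvv M) nilM (subvv M) sUM neUM subM MU.
have Uv x u : x \in M -> u \in (U + <[v]>)%VS -> lie x u \in U.
  move=> Mx /memv_addP[w Uw [_ /vlineP[a ->] ->]].
  rewrite linearD linearZ /=; apply: memvD; first exact: MU. apply: memvZ. exact: Mv_U.
case/negP: nUv; rewrite -(maxU (U + <[v]>)%VS) ?addvSl ?(subvP (addvSr _ _)) ?memv_line //.
split.
- by rewrite subv_add sUM -memvE.
- by move=> x u Mx /(Uv x u Mx); apply/subvP/addvSl.
exists n.+1; apply/eqP; rewrite -subv0 -Un iterSr.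
have sU : (liev M (U + <[v]>) <= U)%VS by apply/lievP.
by elim: {Un} n => //= k IHk; apply: lievS.
Qed.

(** Since [y] is a multiple of [lie x y], it survives in every term of the lower central series. *)
Lemma eigenvector_not_nilpotent M x y a :
  x \in M -> y \in M -> y != 0 -> a != 0 -> lie x y = a *: y -> ~ nilpotent_subalgebra M.
Proof.
move=> Mx My y0 a0 xy [n Mn]; case/negP: y0; rewrite -memv0 -Mn.
elim: {Mn} n => //= n IHn; rewrite -[y](scalerK a0) -xy memvZ //.
exact: memv_lie.
Qed.

Lemma not_solvable_not_nilpotent : ~ solvable L -> ~ nilpotent_subalgebra {:L}%VS.
Proof.
move=> nsol [n Ln]; apply: nsol; exists n; apply/eqP; rewrite -subv0 -Ln.
exact: derived_series_le_lower_central.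
Qed.

(** By the Leibniz rule [ad x] turns [lie u v] into two brackets, each with one exponent lowered;
    hence the double induction. *)
Lemma fitting_null_lie x u v m n :
  iter m (lie x) u = 0 -> iter n (lie x) v = 0 -> exists k, iter k (lie x) (lie u v) = 0.
Proof.
elim: m u v n => [|m IHm] u v n; first by move=> /= -> _; exists 0%N; rewrite lie0l.
elim: n v => [|n IHn] v; first by move=> _ /= ->; exists 0%N; rewrite lie0r.
move=> um vn; have [k uk] := IHm (lie x u) v n.+1 (etrans (esym (iterSr _ _ _)) um) vn.
have [l vl] := IHn (lie x v) um (etrans (esym (iterSr _ _ _)) vn).
exists (maxn k l).+1; rewrite iterSr lie_derivation.
have := iter_linear (lie x) (maxn k l) 1 (lie (lie x u) v) (lie u (lie x v)).
rewrite !scale1r => ->.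
by rewrite (iter_eq0_le (leq_maxl k l) uk) (iter_eq0_le (leq_maxr k l) vl) addr0.
Qed.

Lemma fitting_null x : exists2 U, is_subalgebra U &
  forall v, v \in U <-> exists n, iter n (lie x) v = 0.
Proof.
have [||U UP] := @exists_vspace_of F L (fun v => exists n, iter n (lie x) v = 0).
- by exists 0%N.
- move=> a u v [m um] [n vn]; exists (maxn m n); rewrite iter_linear.
  by rewrite (iter_eq0_le (leq_maxl _ _) um) (iter_eq0_le (leq_maxr _ _) vn) scaler0 addr0.
exists U => // u v /UP[m um] /UP[n vn]; apply/UP; exact: fitting_null_lie um vn.
Qed.

End LieAlgebras.

(** * Weights of [ad x] and maximal subalgebras spanned by two vectors *)

Section Weights.
Variables (F : closedFieldType) (L : lieAlgType F).
Implicit Types (x y z u v w : L) (S T U V W M : {vspace L}).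

(** Engel's theorem gives an [ad x] that is not nilpotent on [M]. Take an eigenvector [w] modulo the
    Fitting null component: a power of [ad x] kills the error and turns [w] into a true
    eigenvector. *)
Lemma exists_eigenvector M : is_subalgebra M -> ~ nilpotent_subalgebra M ->
  exists x y a, [/\ x \in M, y \in M, y != 0, a != 0 & lie x y = a *: y].
Proof.
move=> subM nnilM; apply: contrapT => noeig; apply/nnilM/engel => // x v Mx Mv.
apply: contrapT => nv.
have [||||a [w [Mw nw [n nxw]]]] := @exists_eigen_mod F L (lie x)
  (fun w => w \in M) (fun w => exists n, iter n (lie x) w = 0) v.
- by move=> a w Mw; rewrite memvB ?memvZ ?subM.
- by exists 0%N.
- by [].
- by [].
have xw : lie x (iter n (lie x) w) = a *: iter n (lie x) w.
  have := iter_linear (lie x) n (- a) w (lie x w).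
  rewrite -iterSr !scaleNr [- (a *: w) + _]addrC nxw iterS.
  by move/esym/eqP; rewrite addrC subr_eq0 => /eqP.
apply: noeig; exists x, (iter n (lie x) w), a; split => //.
- by elim: {nxw xw} n => //= n IHn; apply: subM.
- by apply: contra_notN nw => /eqP; exists n.
by apply: contra_notN nw => /eqP a0; exists n.+1; rewrite iterS xw a0 scale0r.
Qed.

Lemma line2_subalgebra x y a : lie x y = a *: y -> is_subalgebra (<[x]> + <[y]>)%VS.
Proof.
move=> xy; apply: subalgebraDline => [_ _ /vlineP[p ->] /vlineP[q ->]|_ /vlineP[p ->]].
  by rewrite lieZl linearZ /= liexx !scaler0 mem0v.
by rewrite lieZl xy; apply/mem_line2P; exists 0, (p * a); rewrite scale0r add0r scalerA.
Qed.

Lemma line2_solvable x y a :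
  lie x y = a *: y -> (<[x]> + <[y]>)%VS = fullv -> solvable L.
Proof.
move=> xy xyL; exists 2%N; apply/eqP; rewrite -subv0 /=.
have sy : (liev fullv fullv <= <[y]>)%VS.
  apply/lievP => u v _ _; have [/mem_line2P[p [q ->]] /mem_line2P[p' [q' ->]]] :
    u \in (<[x]> + <[y]>)%VS /\ v \in (<[x]> + <[y]>)%VS by rewrite xyL !memvf.
  rewrite lieDl !linearD /= !lieZl !linearZ /= !liexx (lieC y) xy !scaler0 add0r addr0.
  by rewrite memvD ?memvZ ?memvN ?memvZ ?memv_line.
apply: subv_trans (lievS sy sy) _; apply/lievP => _ _ /vlineP[p ->] /vlineP[q ->].
by rewrite lieZl linearZ /= liexx !scaler0 mem0v.
Qed.

(* A non-nilpotent maximal subalgebra contains some nonabelian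
   [<x> + <y>], and equals it because its own maximal subalgebras are nilpotent. *)
Lemma line2_maximal x y a :
  (forall S, is_2maximal_subalgebra S -> nilpotent_subalgebra S) -> ~ solvable L ->
  y != 0 -> a != 0 -> lie x y = a *: y ->
  is_maximal_subalgebra (<[x]> + <[y]>)%VS fullv.
Proof.
move=> nil2 nsol y0 a0 xy; set B := (<[x]> + <[y]>)%VS.
have subB : is_subalgebra B by apply: line2_subalgebra xy.
have [Bx By] : x \in B /\ y \in B.
  by rewrite (subvP (addvSl _ _)) ?(subvP (addvSr _ _)) ?memv_line.
have nnil S : (B <= S)%VS -> ~ nilpotent_subalgebra S.
  by move=> /subvP sBS; apply: eigenvector_not_nilpotent xy; rewrite ?sBS.
have [|M maxM sBM] := exists_maximal_subalgebra subB (subvf B).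
  by move=> /(line2_solvable xy).
have [<- //|neBM] := pselect (M = B).
have [|S maxS sBS] := exists_maximal_subalgebra subB sBM; first by move=> /esym.
by case: (nnil S sBS); apply: nil2; exists M.
Qed.

(** This is [mxtrace_weight] with [b] the coordinate rows of [x] and [y]; [D] is the matrix of
    [ad x] on their span, of trace [a]. *)
Lemma mxtrace_ad x y a :
  2%:R != 0 :> F -> y != 0 -> a != 0 -> lie x y = a *: y ->
  (forall v, lie y v \in (<[x]> + <[y]>)%VS -> v \in (<[x]> + <[y]>)%VS) ->
  \tr (mx_of (lie x)) = a.
Proof.
move=> char2 y0 a0 xy injy.
pose b := col_mx (row_of x) (row_of y).
pose D : 'M_(1 + 1) := block_mx 0 0 0 a%:M.
have sub_b v : (row_of v <= b)%MS = (v \in (<[x]> + <[y]>)%VS).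
  apply/submxP/mem_line2P => [[d]|[p [q ->]]].
    rewrite -[d]hsubmxK mul_row_col [lsubmx d]mx11_scalar [rsubmx d]mx11_scalar.
    rewrite !mul_scalar_mx => vE; exists (lsubmx d 0 0), (rsubmx d 0 0).
    by apply: row_of_inj; rewrite row_ofP vE [in RHS]/row_of linearZ.
  exists (row_mx p%:M q%:M); rewrite mul_row_col !mul_scalar_mx row_ofP.
  by rewrite /row_of linearZ.
have <- : \tr D = a by rewrite mxtrace_block mxtrace0 add0r mxtrace_scalar.
apply: (@mxtrace_weight F _ _ (mx_of (lie x)) (mx_of (lie y)) b D a) => //.
- apply: inj_row_free => d; rewrite -[d]hsubmxK mul_row_col.
  rewrite [lsubmx d]mx11_scalar [rsubmx d]mx11_scalar !mul_scalar_mx.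
  move: (lsubmx d 0 0) (rsubmx d 0 0) => p q pq.
  have xy0 : p *: x + q *: y = 0.
    by apply: row_of_inj; rewrite row_ofP /row_of linearZ /= linear0.
  have p0 : p = 0.
    have := congr1 (lie^~ y) xy0; rewrite lieDl !lieZl liexx scaler0 addr0 xy lie0l.
    by move=> /eqP; rewrite !scaler_eq0 (negPf a0) (negPf y0) !orbF => /eqP.
  move: xy0; rewrite p0 scale0r add0r => /eqP; rewrite scaler_eq0 (negPf y0) orbF.
  by move=> /eqP->; rewrite !raddf0 row_mx0.
- rewrite mul_col_mx mul_block_col !row_of_mul /= liexx xy !mul0mx !add0r.
  by rewrite mul_scalar_mx /row_of linear0 linearZ.
- rewrite mul_col_mx col_mx_sub !row_of_mul !sub_b /= liexx mem0v andbT lieC xy.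
  by rewrite memvN memvZ // (subvP (addvSr _ _)) ?memv_line.
- by move=> r; have [v <-] := row_of_onto r; rewrite row_of_mul !sub_b; apply: injy.
apply/row_matrixP => i; rewrite !rowE; have [v <-] := row_of_onto (delta_mx 0 i).
rewrite mulmxDr -scalemxAr !mulmxA !row_of_mul /= lie_derivation xy lieZl row_ofP.
by rewrite addrC.
Qed.

(* If no such [y] were ad-nilpotent, each [ad y] would be invertible on [L / (<x> + <y>)], so each nonzero
   eigenvalue of [ad x] would equal its trace, while the spectrum of [ad x] on
   that quotient is invariant under translation by [a]. *)
Lemma exists_nilpotent_eigenvector x :
  2%:R != 0 :> F ->
  (forall y a, y != 0 -> a != 0 -> lie x y = a *: y ->
     is_maximal_subalgebra (<[x]> + <[y]>)%VS fullv) ->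
  (exists y a, [/\ y != 0, a != 0 & lie x y = a *: y]) ->
  exists y a, [/\ y != 0, a != 0, lie x y = a *: y &
    forall v, exists n, iter n (lie y) v = 0].
Proof.
move=> char2 maxB [y [a [y0 a0 xy]]]; apply: contrapT => nonil.
(* The null component of [ad y'] is a subalgebra containing [<[x]> + <[y']>]; it is not [L], as [y']
   would then be ad-nilpotent, so maximality makes it that plane. *)
have injad y' a' v : y' != 0 -> a' != 0 -> lie x y' = a' *: y' ->
    lie y' v \in (<[x]> + <[y']>)%VS -> v \in (<[x]> + <[y']>)%VS.
  move=> y'0 a'0 xy' Byv; have [subB _ _ maxB'] := maxB _ _ y'0 a'0 xy'.
  have [U subU UP] := fitting_null y'.
  have sBU : (<[x]> + <[y']> <= U)%VS.
    rewrite subv_add -!memvE; apply/andP; split; apply/UP; last by exists 1%N; apply: liexx.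
    by exists 2%N; rewrite /= (lieC y' x) xy' linearN linearZ /= liexx scaler0 oppr0.
  have [UB|UL] := maxB' U subU sBU (subvf U).
    rewrite -UB; apply/UP; have [n ny] := (UP _).1 (subvP sBU _ Byv).
    by exists n.+1; rewrite iterSr.
  case: nonil; exists y', a'; split=> // w; apply/UP; rewrite UL; exact: memvf.
have trE y' a' : y' != 0 -> a' != 0 -> lie x y' = a' *: y' -> a' = \tr (mx_of (lie x)).
  move=> y'0 a'0 xy'; apply/esym/(mxtrace_ad _ y'0 a'0 xy') => // w.
  exact: injad xy'.
have [subB _ neBL _] := maxB y a y0 a0 xy; set B := (<[x]> + <[y]>)%VS in subB neBL.
have /subvPn[v _ nBv] : ~~ (fullv <= B)%VS.
  by apply/negP => sLB; apply: neBL; apply/eqP; rewrite eqEsubv subvf.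
have [||||l [z [_ /negP nBz Bz]]] := @exists_eigen_mod F L (lie x)
  (fun=> True) (fun w => w \in B) v => //; [exact: mem0v | exact/negP |].
(* When [l'] is neither 0 nor [a], subtracting a suitable element of [B] makes [w] a true
   eigenvector, and then [l'] and [a] both equal the trace. *)
have weight l' w : w \notin B -> lie x w - l' *: w \in B -> l' = 0 \/ l' = a.
  move=> nBw /mem_line2P[p [q xw]]; have [-> | l'0] := eqVneq l' 0; first by left.
  right; apply: contrapT => /eqP l'a.
  (* On [B] the operator [ad x - l'] multiplies [x] by [- l'] and [y] by [a - l'], which dictates
     the coefficients of [w']. *)
  pose c := q / (a - l'); have qE : q = (a - l') * c.
    by rewrite mulrC divfK // subr_eq0 eq_sym.
  pose w' := w + (p / l') *: x - c *: y.
  have xw' : lie x w' = l' *: w'.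
    rewrite /w' linearB linearD !linearZ /= liexx scaler0 addr0 xy (canRL (subrK _) xw).
    rewrite !scalerN scalerBr scalerDr !scalerA mulrCA divff // mulr1 (mulrC c) qE mulrBl scalerBl.
    by rewrite [_ + l' *: w]addrC !addrA [LHS]addrAC addrK.
  have w'0 : w' != 0.
    apply: contraNneq nBw => /eqP; rewrite subr_eq0 => /eqP/(canRL (addrK _)) ->.
    apply/mem_line2P; exists (- (p / l')), c.
    by rewrite addrC scaleNr.
  by rewrite (trE w' l' w'0 l'0 xw') -(trE y a y0 a0 xy) eqxx in l'a.
have step l' w : w \notin B -> lie x w - l' *: w \in B ->
    lie y w \notin B /\ lie x (lie y w) - (l' + a) *: lie y w \in B.
  move=> nBw Bw; split; first by apply: contra nBw; apply: injad xy.
  have -> : lie x (lie y w) - (l' + a) *: lie y w = lie y (lie x w - l' *: w).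
    rewrite [RHS]linearB [in RHS]linearZ /= lie_derivation xy lieZl scalerDl.
    by rewrite [l' *: _ + _]addrC opprD addrA [a *: _ + _]addrC addrK.
  by apply: subB => //; rewrite (subvP (addvSr _ _)) ?memv_line.
have a2 : a + a <> 0 by apply/eqP; rewrite -mulr2n -mulr_natr mulf_neq0.
have [nBz1 Bz1] := step _ _ nBz Bz; have [nBz2 Bz2] := step _ _ nBz1 Bz1.
(* Either way [a + a] occurs as a weight, yet it is neither 0 nor [a]. *)
have [l0 | la] := weight _ _ nBz Bz.
  have [/eqP | /eqP] := weight _ _ nBz2 Bz2; rewrite l0 add0r => /eqP //.
  by move=> /(canRL (addrK _)); rewrite subrr => aE; rewrite aE eqxx in a0.
have [/eqP | /eqP] := weight _ _ nBz1 Bz1; rewrite la => /eqP //.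
by move=> /(canRL (addrK _)); rewrite subrr => aE; rewrite aE eqxx in a0.
Qed.

End Weights.

(** * Triples with the relations of [sl2] *)

Section SL2Triples.
Variables (F : fieldType) (L : lieAlgType F).
Implicit Types (e f h x y z u v w : L) (a b c : F).

Definition sl2_triple e f h :=
  [/\ lie h e = 2%:R *: e, lie h f = - (2%:R *: f) & lie e f = h].

Definition comb3 e f h a b c : L := a *: e + b *: f + c *: h.

Lemma comb3P e f h v :
  reflect (exists a b c, v = comb3 e f h a b c) (v \in (<[e]> + <[f]> + <[h]>)%VS).
Proof.
apply: (iffP memv_addP) => [[_ /mem_line2P[a [b ->]] [_ /vlineP[c ->] ->]]|[a [b [c ->]]]].
  by exists a, b, c.
exists (a *: e + b *: f); first by apply/mem_line2P; exists a, b.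
by exists (c *: h); rewrite ?memvZ ?memv_line.
Qed.

Lemma comb3D e f h a b c a' b' c' :
  comb3 e f h a b c + comb3 e f h a' b' c' = comb3 e f h (a + a') (b + b') (c + c').
Proof. by rewrite /comb3 !scalerDl addrACA [a *: e + _ + _]addrACA. Qed.

Lemma comb3Z e f h k a b c :
  k *: comb3 e f h a b c = comb3 e f h (k * a) (k * b) (k * c).
Proof. by rewrite /comb3 !scalerDr !scalerA. Qed.

Lemma lie_comb3 e f h a b c a' b' c' : sl2_triple e f h ->
  lie (comb3 e f h a b c) (comb3 e f h a' b' c') =
  comb3 e f h (2%:R * (c * a' - a * c')) (2%:R * (b * c' - c * b')) (a * b' - b * a').
Proof.
move=> [he hf ef].
have E1 w : lie w (comb3 e f h a' b' c') = a' *: lie w e + b' *: lie w f + c' *: lie w h.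
  by rewrite /comb3 !linearD !linearZ.
have Ee : lie e (comb3 e f h a' b' c') = comb3 e f h (- (2%:R * c')) 0 b'.
  rewrite E1 liexx ef (lieC e) he /comb3 scaler0 add0r scale0r addr0 addrC.
  by rewrite scalerN scaleNr scalerA mulrC.
have Ef : lie f (comb3 e f h a' b' c') = comb3 e f h 0 (2%:R * c') (- a').
  rewrite E1 liexx (lieC f e) (lieC f h) ef hf /comb3 scaler0 addr0 scale0r add0r addrC.
  by rewrite opprK scalerN scaleNr scalerA mulrC.
have Eh : lie h (comb3 e f h a' b' c') = comb3 e f h (2%:R * a') (- (2%:R * b')) 0.
  by rewrite E1 liexx he hf /comb3 scaler0 scale0r scalerN scaleNr !scalerA !(mulrC 2%:R).
rewrite {1}/comb3 !lieDl !lieZl Ee Ef Eh !comb3Z !comb3D; congr comb3; ring.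
Qed.

Lemma sl2_triple_subalgebra e f h :
  sl2_triple e f h -> is_subalgebra (<[e]> + <[f]> + <[h]>)%VS.
Proof.
move=> tr _ _ /comb3P[a [b [c ->]]] /comb3P[a' [b' [c' ->]]].
by rewrite lie_comb3 //; apply/comb3P; do 3 eexists.
Qed.

(** Applying [ad e] twice leaves [- 2 b e], so [b = 0]; applying it once then gives [c = 0]. *)
Lemma sl2_triple_free e f h a b c : 2%:R != 0 :> F -> sl2_triple e f h -> h != 0 ->
  comb3 e f h a b c = 0 -> [/\ a = 0, b = 0 & c = 0].
Proof.
move=> char2 tr h0 abc0; have [_ _ ef] := tr.
have e0 : e != 0 by apply: contraNneq h0 => e0; rewrite -ef e0 lie0l.
have eE : comb3 e f h 1 0 0 = e by rewrite /comb3 !scale0r !addr0 scale1r.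
have ad_e a' b' c' : lie e (comb3 e f h a' b' c') = comb3 e f h (- (2%:R * c')) 0 b'.
  by rewrite -{1}eE lie_comb3 //; congr comb3; ring.
have scal_e k : comb3 e f h k 0 0 = 0 -> k = 0.
  by rewrite /comb3 !scale0r !addr0 => /eqP; rewrite scaler_eq0 (negPf e0) orbF => /eqP.
have twoE (k : F) : - (2%:R * k) = 0 -> k = 0.
  by move=> /eqP; rewrite oppr_eq0 mulf_eq0 (negPf char2) => /eqP.
have bc0 := congr1 (lie e) abc0; rewrite ad_e lie0r in bc0.
have b0 : b = 0 by have := congr1 (lie e) bc0; rewrite ad_e lie0r => /scal_e/twoE.
have c0 : c = 0 by move: bc0; rewrite b0 => /scal_e/twoE.
by split=> //; apply: scal_e; rewrite b0 c0 in abc0.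
Qed.

End SL2Triples.

(** * Coordinates on trace-zero matrices *)

Section SL2Matrices.
Variable F : fieldType.
Implicit Types a b c : F.

(** The arguments follow the order [e], [f], [h] of [comb3]. *)
Definition sl2_of_mx a b c : 'M[F]_2 :=
  \matrix_(i, j) if i == 0 then (if j == 0 then c else a)
                 else (if j == 0 then b else - c).

Fact sl2_of_subproof a b c :
  sl2_of_mx a b c \in lker (linfun (@mxtrace F 2 : 'M[F]_2 -> F^o)).
Proof. by rewrite mem_sl2 /mxtrace !big_ord_recl big_ord0 !mxE /= addr0 addrN. Qed.

Definition sl2_of a b c : sl2 F := Subvs (sl2_of_subproof a b c).

Lemma sl2_ofE A : A = sl2_of (sl2_mx A 0 1) (sl2_mx A 1 0) (sl2_mx A 0 0).
Proof.
apply: sl2_mx_inj; apply/matrixP => i j; rewrite mxE.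
have /eqP trA : \tr (sl2_mx A) == 0 by rewrite -mem_sl2; apply: subvsP.
have defA : sl2_mx A 1 1 = - sl2_mx A 0 0.
  apply/eqP; rewrite -addr_eq0 addrC -trA /mxtrace !big_ord_recl big_ord0 addr0.
  by apply/eqP; congr (sl2_mx A _ _ + sl2_mx A _ _); apply: val_inj.
case: eqP => [->|/eqP i0].
  by case: eqP => [->//|/eqP j0]; congr (sl2_mx A _ _); case: j j0 => [[|[]]] //= *; apply: val_inj.
have -> : i = 1 by case: i i0 => [[|[]]] //= *; apply: val_inj.
case: eqP => [->//|/eqP j0]; rewrite -defA.
by congr (sl2_mx A _ _); case: j j0 => [[|[]]] //= *; apply: val_inj.
Qed.

Lemma sl2_ofD a b c a' b' c' :
  sl2_of a b c + sl2_of a' b' c' = sl2_of (a + a') (b + b') (c + c').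
Proof.
apply: sl2_mx_inj; rewrite linearD; apply/matrixP => i j; rewrite !mxE.
by case: (i == 0); case: (j == 0) => //; rewrite opprD.
Qed.

Lemma sl2_ofZ k a b c : k *: sl2_of a b c = sl2_of (k * a) (k * b) (k * c).
Proof.
apply: sl2_mx_inj; rewrite linearZ; apply/matrixP => i j; rewrite !mxE.
by case: (i == 0); case: (j == 0) => //; rewrite mulrN.
Qed.

(** The structure constants agree with those of [lie_comb3], so matching coordinates preserves
    brackets. *)
Lemma lie_sl2_of a b c a' b' c' : lie (sl2_of a b c) (sl2_of a' b' c') =
  sl2_of (2%:R * (c * a' - a * c')) (2%:R * (b * c' - c * b')) (a * b' - b * a').
Proof.
apply: sl2_mx_inj; apply/matrixP => i j.
rewrite sl2_mx_bracket !mxE !big_ord_recl !big_ord0 !mxE /=.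
by case: (i == 0); case: (j == 0) => /=; ring.
Qed.

Lemma sl2_of_triple : sl2_triple (sl2_of 1 0 0) (sl2_of 0 1 0) (sl2_of 0 0 1).
Proof.
split; rewrite !lie_sl2_of -?scaleNr ?sl2_ofZ; congr sl2_of; ring.
Qed.

Lemma comb3_sl2_of a b c :
  comb3 (sl2_of 1 0 0) (sl2_of 0 1 0) (sl2_of 0 0 1) a b c = sl2_of a b c.
Proof. by rewrite /comb3 !sl2_ofZ !sl2_ofD; congr sl2_of; ring. Qed.

Lemma sl2_of_neq0 : sl2_of 0 0 1 != 0.
Proof.
apply/eqP => /(congr1 (fun A => sl2_mx A 0 0)); rewrite linear0 !mxE /=.
by apply/eqP; rewrite oner_eq0.
Qed.

End SL2Matrices.

(** * Isomorphism with [sl2] in terms of triples *)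

Section SL2Isomorphism.
Variables (F : fieldType) (L : lieAlgType F).
Hypothesis char2 : 2%:R != 0 :> F.

(** The isomorphism reads off chosen coordinates; freeness of the triple makes them unique, hence
    linear. *)
Lemma lie_isomorphic_sl2 (e f h : L) :
  sl2_triple e f h -> h != 0 -> (<[e]> + <[f]> + <[h]>)%VS = fullv ->
  lie_isomorphic L (sl2 F).
Proof.
move=> tr h0 efh.
have coordP v : exists t : F * F * F, v = comb3 e f h t.1.1 t.1.2 t.2.
  have /comb3P[a [b [c ->]]] : v \in (<[e]> + <[f]> + <[h]>)%VS by rewrite efh memvf.
  by exists (a, b, c).
have [t tE] := choice coordP.
pose phi v := sl2_of (t v).1.1 (t v).1.2 (t v).2.
have phiE a b c : phi (comb3 e f h a b c) = sl2_of a b c.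
  have := tE (comb3 e f h a b c); rewrite /phi; move: (t _) => [[a' b'] c'] /=.
  move=> /(congr1 (fun v => v + (-1) *: comb3 e f h a' b' c')).
  rewrite scaleN1r addrN -scaleN1r comb3Z comb3D.
  move=> /(sl2_triple_free char2 tr h0); rewrite !mulN1r.
  by case=> /subr0_eq-> /subr0_eq-> /subr0_eq->.
have phi_linear : linear phi.
  move=> k u v; rewrite (tE u) (tE v) comb3Z comb3D !phiE.
  by rewrite sl2_ofZ sl2_ofD.
pose Phi : {linear L -> sl2 F} := HB.pack phi (GRing.isLinear.Build _ _ _ _ phi phi_linear).
exists Phi; split.
  exists (fun A => comb3 e f h (sl2_mx A 0 1) (sl2_mx A 1 0) (sl2_mx A 0 0)) => [v|A] /=.
    by rewrite [RHS]tE /phi !mxE.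
  by rewrite phiE -sl2_ofE.
move=> u v /=; rewrite (tE u) (tE v) lie_comb3 // !phiE lie_sl2_of //.
Qed.

Lemma sl2_triple_of_isomorphic : lie_isomorphic L (sl2 F) ->
  exists e f h : L, [/\ sl2_triple e f h, h != 0 & (<[e]> + <[f]> + <[h]>)%VS = fullv].
Proof.
move=> [phi [[psi phiK psiK] phi_lie]].
have [he hf ef] := sl2_of_triple F.
exists (psi (sl2_of 1 0 0)), (psi (sl2_of 0 1 0)), (psi (sl2_of 0 0 1)); split.
- split; apply: (can_inj phiK); rewrite phi_lie ?linearN ?linearZ /= !psiK ?scalerN //.
- apply: contraNneq (sl2_of_neq0 F) => psi0.
  by apply/eqP; rewrite -[LHS]psiK psi0 linear0.
apply/eqP; rewrite eqEsubv subvf /=; apply/subvP => v _; apply/comb3P.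
exists (sl2_mx (phi v) 0 1), (sl2_mx (phi v) 1 0), (sl2_mx (phi v) 0 0).
apply: (can_inj phiK); rewrite /comb3 !linearD !linearZ /= !psiK.
by rewrite -[RHS]/(comb3 _ _ _ _ _ _) comb3_sl2_of -sl2_ofE.
Qed.

End SL2Isomorphism.

(** * Lifting [sl2] through an ideal with nilpotent action *)

Section NilpotentAction.
Variables (F : fieldType) (L : lieAlgType F).
Implicit Types (e f h x y z u v w : L) (P S : {vspace L}).

Lemma nilpotent_weight_eq0 x w c :
  c != 0 -> lie x w = c *: w -> (exists n, iter n (lie x) w = 0) -> w = 0.
Proof.
move=> c0 xw [n]; rewrite (iter_eigen (f := lie x) n xw) => /eqP.
by rewrite scaler_eq0 expf_eq0 (negPf c0) andbF => /eqP.
Qed.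

(** A truncated geometric series inverts [ad x - c]: if [v] solves the equation for [lie x u], then
    [c^-1 *: (v - u)] solves it for [u]. *)
Lemma nilpotent_sub_scalar_onto x P c u :
  c != 0 -> (forall v, v \in P -> lie x v \in P) -> u \in P ->
  (exists n, iter n (lie x) u = 0) -> exists2 v, v \in P & lie x v - c *: v = u.
Proof.
move=> c0 Px Pu [n]; elim: n u Pu => [|n IHn] u Pu.
  by move=> /= ->; exists 0; rewrite ?mem0v // lie0r scaler0 subr0.
rewrite iterSr => /(IHn _ (Px _ Pu))[v Pv xv].
exists (c^-1 *: (v - u)); first by rewrite memvZ ?memvB.
rewrite linearZ linearB /= -xv opprB addrC [lie x v + _]addrC subrK.
by rewrite !scalerA divff // mulVf // !scale1r opprB subrK.
Qed.

(** Any lift of [u] misses the weight equation by an element of [P], which [ad x - c] attains on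
    [P]. *)
Lemma lift_weight P (idP : is_ideal P) x (u : quot_lie idP) c : c != 0 ->
  (forall v, v \in P -> exists n, iter n (lie x) v = 0) ->
  lie (quot_proj idP x) u = c *: u ->
  exists2 v, quot_proj idP v = u & lie x v = c *: v.
Proof.
move=> c0 nilx xu; pose v := quot_repr u.
have Pw : lie x v - c *: v \in P.
  by rewrite -(quot_proj_eq0 idP) linearB linearZ /= quot_proj_lie quot_reprK xu subrr.
have [w Pw' xw] := nilpotent_sub_scalar_onto c0 (idP x) Pw (nilx _ Pw).
exists (v - w).
  have /eqP w0 : quot_proj idP w == 0 by rewrite quot_proj_eq0.
  by rewrite linearB /= w0 subr0 quot_reprK.
rewrite linearB scalerBr /= (canRL (subrK _) xw).
by rewrite opprD opprB addrA [lie x v + _]addrC subrK.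
Qed.

(* An [sl2]-triple of [L / P] lifts to [L] by taking true weight vectors for [h] and
   replacing [h] by the bracket of the other two. *)
Lemma lift_sl2_triple P (idP : is_ideal P) (e f h : quot_lie idP) :
  2%:R != 0 :> F -> acts_nilpotently P -> sl2_triple e f h ->
  exists e' f' h', [/\ sl2_triple e' f' h', quot_proj idP e' = e,
    quot_proj idP f' = f & quot_proj idP h' = h].
Proof.
move=> char2 nilP [he hf ef]; pose h0 := quot_repr h.
have nil0 x v : v \in P -> exists n, iter n (lie x) v = 0.
  by move=> Pv; have [n nP] := nilP x; exists n; apply: nP.
have h0E : quot_proj idP h0 = h by rewrite quot_reprK.
have hf' : lie h f = (- 2%:R) *: f by rewrite scaleNr.
have char2' : - 2%:R != 0 :> F by rewrite oppr_eq0.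
have [e' e'E h0e] := lift_weight char2 (nil0 h0) (etrans (congr1 (lie^~ e) h0E) he).
have [f' f'E h0f] := lift_weight char2' (nil0 h0) (etrans (congr1 (lie^~ f) h0E) hf').
have h'E : quot_proj idP (lie e' f') = h by rewrite quot_proj_lie e'E f'E.
have h0h : lie h0 (lie e' f') = 0 *: lie e' f' by rewrite (lie_weight h0e h0f) subrr.
(* The bracket [lie e' f'] has weight 0 for [h0], so the error in the claimed identity has weight
   [c]; it lies in [P], where [ad h0] is nilpotent, so it vanishes. *)
have weight (c : F) v (u : quot_lie idP) : c != 0 -> quot_proj idP v = u ->
    lie h0 v = c *: v -> lie h u = c *: u -> lie (lie e' f') v = c *: v.
  move=> c0 vE h0v hu; apply/eqP; rewrite -subr_eq0; apply/eqP.
  apply: (@nilpotent_weight_eq0 h0 _ c c0).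
    by rewrite linearB linearZ /= (lie_weight h0h h0v) add0r h0v scalerBr.
  by apply: nil0; rewrite -(quot_proj_eq0 idP) linearB linearZ /= quot_proj_lie h'E vE hu subrr.
exists e', f', (lie e' f'); split=> //; split=> //; first exact: (weight _ _ e).
by rewrite (weight _ _ f char2' f'E h0f hf') scaleNr.
Qed.

Lemma frattini_eq0_of_sl2_quotient :
  2%:R != 0 :> F -> lie_isomorphic (quot_lie (@frattini_ideal F L)) (sl2 F) ->
  acts_nilpotently (frattini L) -> frattini L = 0%VS /\ (\dim {:L} <= 3)%N.
Proof.
move=> char2 /sl2_triple_of_isomorphic[e [f [h [tr h0 efh]]]] nilP.
have [e' [f' [h' [tr' eE fE hE]]]] := lift_sl2_triple char2 nilP tr.
have [_ inmaxP _] := frattiniP L.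
have projE a b c : quot_proj (@frattini_ideal F L) (comb3 e' f' h' a b c) = comb3 e f h a b c.
  by rewrite /comb3 !linearD !linearZ /= eE fE hE.
set K := (<[e']> + <[f']> + <[h']>)%VS.
(* [K] and the Frattini ideal together span [L]; a maximal subalgebra containing [K] would contain
   both. *)
have KL : K = fullv.
  apply: contrapT => neK.
  have [M maxM sKM] := exists_maximal_subalgebra (sl2_triple_subalgebra tr') (subvf K) neK.
  have [_ _ neML _] := maxM; apply: neML; apply/eqP; rewrite eqEsubv subvf /=.
  apply/subvP => v _.
  have /comb3P[a [b [c vE]]] : quot_proj (@frattini_ideal F L) v \in (<[e]> + <[f]> + <[h]>)%VS.
    by rewrite efh memvf.
  rewrite -[v](subrK (comb3 e' f' h' a b c)) memvD //.
    apply: (subvP (inmaxP M maxM)).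
    by rewrite -(quot_proj_eq0 (@frattini_ideal F L)) linearB /= vE projE subrr.
  by apply: (subvP sKM); apply/comb3P; exists a, b, c.
split.
  (* An element of the Frattini ideal is a combination of the lifted triple that vanishes in the
     quotient, where the triple is free. *)
  apply/eqP; rewrite -subv0; apply/subvP => v Pv.
  have /comb3P[a [b [c vE]]] : v \in K by rewrite KL memvf.
  move: Pv; rewrite -(quot_proj_eq0 (@frattini_ideal F L)) vE projE => /eqP.
  by move=> /(sl2_triple_free char2 tr h0)[-> -> ->]; rewrite /comb3 !scale0r !addr0 mem0v.
rewrite -KL (leq_trans (dimv_add_leqif _ _)) // -addn1 leq_add ?dim_vline ?leq_b1 //.
by rewrite (leq_trans (dimv_add_leqif _ _)) // !dim_vline; case: (_ != 0); case: (_ != 0).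
Qed.

Lemma dim1_nilpotent S : (\dim S <= 1)%N -> nilpotent_subalgebra S.
Proof.
move=> dimS; exists 1%N; apply/eqP; rewrite -subv0 /=; apply/lievP => x y Sx Sy.
have [-> | x0] := eqVneq x 0; first by rewrite lie0l mem0v.
have defS : <[x]>%VS = S by apply/eqP; rewrite eqEdim -memvE Sx dim_vline x0.
by move: Sy; rewrite -defS => /vlineP[c ->]; rewrite linearZ /= liexx scaler0 mem0v.
Qed.

Lemma dim3_2maximal_nilpotent S :
  (\dim {:L} <= 3)%N -> is_2maximal_subalgebra S -> nilpotent_subalgebra S.
Proof.
move=> dimL [S1 [_ sSS1 neS _] [_ sS1 neS1 _]]; apply: dim1_nilpotent.
have ltdim (U V : {vspace L}) : (U <= V)%VS -> U <> V -> (\dim U < \dim V)%N.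
  move=> sUV neUV; rewrite ltn_neqAle dimvS // andbT.
  by apply: contra_notN neUV => dUV; apply/eqP; rewrite eqEdim sUV (eqP dUV) leqnn.
have lt1 := leq_trans (ltdim _ _ sS1 neS1) dimL.
by have := leq_trans (ltdim _ _ sSS1 neS) lt1.
Qed.

End NilpotentAction.

(** * Algebras spanned by [x], [y] and a third vector [z] *)

Section ThreeDimensional.
Variables (F : fieldType) (L : lieAlgType F).
Implicit Types (x y z u v w : L) (a b l p q : F).

(** The derived algebra lies in [W], the second one in [<[y]>], and the third is zero. *)
Lemma solvable_of_weights x y z a b1 b2 l q :
  lie x y = a *: y -> lie x z = l *: z + b1 *: x + b2 *: y -> lie y z = q *: y ->
  (<[x]> + <[y]> + <[z]>)%VS = fullv -> solvable L.
Proof.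
move=> xy xz yz xyz; pose w := lie x z; set W := (<[y]> + <[w]>)%VS.
have [Wy Ww] : y \in W /\ w \in W.
  by rewrite (subvP (addvSl _ _)) ?(subvP (addvSr _ _)) ?memv_line.
have span (Q : L -> Prop) : (forall k u v, Q u -> Q v -> Q (k *: u + v)) ->
    Q 0 -> Q x -> Q y -> Q z -> forall v, Q v.
  move=> Qlin Q0 Qx Qy Qz v.
  have /comb3P[c1 [c2 [c3 ->]]] : v \in (<[x]> + <[y]> + <[z]>)%VS by rewrite xyz memvf.
  rewrite /comb3 -addrA; apply: (Qlin c1) => //; apply: (Qlin c2) => //.
  by rewrite -[_ *: z]addr0; apply: Qlin.
have W1 s : lie s x \in W -> lie s y \in W -> lie s z \in W -> forall v, lie s v \in W.
  apply: span => [k u v Wu Wv|]; last by rewrite lie0r mem0v.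
  by rewrite linearP memvD ?memvZ.
have derW : (liev fullv fullv <= W)%VS.
  apply/lievP => u v _ _; move: u; apply: span => [k u u' Wu Wu'||||].
  - by rewrite lieDl lieZl memvD ?memvZ.
  - by rewrite lie0l mem0v.
  - by apply: W1 => //; rewrite ?liexx ?mem0v // xy memvZ.
  - by apply: W1; rewrite ?liexx ?mem0v // ?yz ?memvZ // lieC xy memvN memvZ.
  by apply: W1; rewrite ?liexx ?mem0v // lieC memvN // yz memvZ.
have yw : lie y w \in <[y]>%VS.
  rewrite /w xz !linearD !linearZ /= liexx scaler0 addr0 yz (lieC y x) xy.
  by rewrite memvD ?memvZ ?memvN ?memvZ ?memv_line.
have derWy : (liev W W <= <[y]>)%VS.
  apply/lievP => _ _ /mem_line2P[c [d ->]] /mem_line2P[c' [d' ->]].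
  rewrite lieDl !linearD /= !lieZl !linearZ /= !liexx (lieC w) !scaler0 add0r addr0.
  by rewrite memvD ?memvZ ?memvN ?memvZ.
exists 3%N; apply/eqP; rewrite -subv0 /=.
apply: (@subv_trans _ _ (liev <[y]> <[y]>)).
  by apply: lievS; apply: subv_trans (lievS derW derW) derWy.
apply/lievP => _ _ /vlineP[c ->] /vlineP[d ->].
by rewrite lieZl linearZ /= liexx !scaler0 mem0v.
Qed.

(** The Jacobi identity forces weight [- a] on [z] modulo [x] and [y]. Once [z] is corrected to a
    true weight vector, rescaling yields the triple. *)
Lemma sl2_triple_of_weights x y z a b1 b2 l p q :
  2%:R != 0 :> F -> a != 0 -> y != 0 -> p != 0 ->
  lie x y = a *: y -> lie x z = l *: z + b1 *: x + b2 *: y -> lie y z = p *: x + q *: y ->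
  (<[x]> + <[y]> + <[z]>)%VS = fullv ->
  exists e f h : L, [/\ sl2_triple e f h, h != 0 & (<[e]> + <[f]> + <[h]>)%VS = fullv].
Proof.
move=> char2 a0 y0 p0 xy xz yz xyz.
have yx : lie y x = - (a *: y) by rewrite lieC xy.
have scal_y k : k *: y = 0 -> k = 0.
  by move=> /eqP; rewrite scaler_eq0 (negPf y0) orbF => /eqP.
(* Bracketing the Jacobi identity for [x], [y], [z] with [y] leaves [(a + l) p a y = 0]. *)
have lE : l = - a.
  have := lie_derivation x y z; rewrite xz yz xy linearD !linearZ /= liexx xy.
  rewrite lieZl yz !linearD !linearZ /= yx liexx yz !scaler0 addr0 add0r.
  move=> /(congr1 (lie^~ y)); rewrite !(lieDl, lieZl, lieNl) liexx xy.
  rewrite !(scaler0, oppr0, addr0) !scalerA -scalerDl => /esym/scal_y alp0.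
  have /eqP : (a + l) * (p * a) = 0 by rewrite -alp0; ring.
  by rewrite !mulf_eq0 (negPf p0) (negPf a0) !orbF addrC addr_eq0 => /eqP.
(* [ad x + a] multiplies [x] by [a] and [y] by [2 a], so [s] and [t] cancel the terms [b1 *: x] and
   [b2 *: y]. *)
pose s := - b1 / a; pose t := - b2 / (2%:R * a); pose z' := z + s *: x + t *: y.
have xz' : lie x z' = - (a *: z').
  have b1E : b1 = - (a * s) by rewrite /s; field.
  have b2E : b2 = - (a * t) - t * a by rewrite /t; field; rewrite a0 char2.
  rewrite /z' !linearD !linearZ /= liexx scaler0 addr0 xy xz lE {1}b1E {1}b2E.
  by rewrite scalerBl addrA [t *: _]scalerA subrK !scalerA !scalerN !scaleNr.
have [q' yz'] : exists q', lie y z' = p *: x + q' *: y.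
  exists (q - s * a); rewrite /z' !linearD !linearZ /= yz yx liexx scaler0 addr0.
  by rewrite scalerN scalerA -addrA -scalerBl.
have q'0 : q' = 0.
  have := lie_derivation x y z'; rewrite yz' xy xz' linearD !linearZ /= liexx xy.
  rewrite scaler0 add0r lieZl linearN /= scalerN subrr scalerA => /scal_y/eqP.
  by rewrite mulf_eq0 (negPf a0) orbF => /eqP.
(* With [e := y], the scale of [h] is fixed by [lie h y = 2 y], and that of [f] by [lie y f = h]. *)
pose h := (2%:R / a) *: x; pose f := (2%:R / (p * a)) *: z'.
have x0 : x != 0 by apply: contraNneq y0 => x0; rewrite -[y](scalerK a0) -xy x0 lie0l scaler0.
have h0 : h != 0 by rewrite scaler_eq0 (negPf x0) orbF mulf_neq0 ?invr_eq0.
exists y, f, h; split=> //.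
  split.
  - by rewrite lieZl xy scalerA divfK.
  - rewrite lieZl linearZ /= xz' !scalerN !scalerA; congr (- (_ *: _)).
    by field; rewrite a0 p0.
  by rewrite linearZ /= yz' q'0 scale0r addr0 scalerA /h; congr (_ *: _); field; rewrite a0.
set K := (_ + _ + _)%VS.
have [Ky [Kf Kh]] : y \in K /\ f \in K /\ h \in K.
  split; last split; apply/comb3P; rewrite /comb3.
  - by exists 1, 0, 0; rewrite !scale0r !addr0 scale1r.
  - by exists 0, 1, 0; rewrite !scale0r addr0 add0r scale1r.
  by exists 0, 0, 1; rewrite !scale0r !add0r scale1r.
have Kx : x \in K.
  have -> : x = (2%:R / a)^-1 *: h by rewrite scalerK // mulf_neq0 ?invr_eq0.
  exact: memvZ.
have Kz' : z' \in K.
  have -> : z' = (2%:R / (p * a))^-1 *: f by rewrite scalerK // !mulf_neq0 ?invr_eq0 ?mulf_neq0.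
  exact: memvZ.
have Kz : z \in K.
  have -> : z = z' - t *: y - s *: x by rewrite /z' addrK addrK.
  by rewrite !memvB ?memvZ.
by apply/eqP; rewrite eqEsubv subvf -xyz !subv_add -!memvE Kx Ky Kz.
Qed.

End ThreeDimensional.

(** * From nilpotent 2-maximal subalgebras to [sl2] *)

Section NilpotentTwoMaximal.
Variables (F : closedFieldType) (L : lieAlgType F).
Implicit Types (x y z u v w : L).

Lemma sl2_triple_of_nilpotent_eigenvector x y a :
  2%:R != 0 :> F -> ~ solvable L -> y != 0 -> a != 0 -> lie x y = a *: y ->
  is_maximal_subalgebra (<[x]> + <[y]>)%VS fullv ->
  (forall v, exists n, iter n (lie y) v = 0) ->
  exists e f h : L, [/\ sl2_triple e f h, h != 0 & (<[e]> + <[f]> + <[h]>)%VS = fullv].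
Proof.
move=> char2 nsol y0 a0 xy [subB _ neB maxB] nily; set B := (_ + _)%VS in subB neB maxB.
have [Bx By] : x \in B /\ y \in B.
  by rewrite (subvP (addvSl _ _)) ?(subvP (addvSr _ _)) ?memv_line.
have /subvPn[v0 _ nBv0] : ~~ (fullv <= B)%VS.
  by apply/negP => sLB; apply: neB; apply/eqP; rewrite eqEsubv subvf.
have [v nBv Byv] : exists2 v, v \notin B & lie y v \in B.
  have [n] := nily v0; elim: n v0 nBv0 => [|n IHn] v nBv.
    by move=> /= v0; rewrite v0 mem0v in nBv.
  rewrite iterSr; have [Byv _|nByv] := boolP (lie y v \in B); first by exists v.
  exact: IHn.
(* The kernel of [ad y] on [L / B] is nonzero by nilpotency and stable under [ad x] because
   [lie x y] is a multiple of [y]. *)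
have [||||l [z [Byz /negP nBz Bxz]]] := @exists_eigen_mod F L (lie x)
  (fun w => lie y w \in B) (fun w => w \in B) v.
- move=> c w Byw; rewrite linearB linearZ /= memvB ?memvZ // lie_derivation (lieC y x) xy.
  by rewrite memvD ?(subB x) // lieNl memvN lieZl memvZ.
- exact: mem0v.
- by [].
- exact/negP.
have /mem_line2P[b1 [b2 xz]] := Bxz; have /mem_line2P[p [q yz]] := Byz.
have {}xz : lie x z = l *: z + b1 *: x + b2 *: y.
  by rewrite -addrA -xz addrC subrK.
have xyz : (<[x]> + <[y]> + <[z]>)%VS = fullv.
  have sB := subvP (addvSl B <[z]>%VS).
  have [z_sub|//] : (B + <[z]>)%VS = B \/ (B + <[z]>)%VS = fullv.
    apply: maxB; rewrite ?addvSl ?subvf //; apply: subalgebraDline => // t /mem_line2P[c [d ->]].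
    rewrite lieDl !lieZl memvD ?memvZ //; last exact: sB.
    have -> : lie x z = (lie x z - l *: z) + l *: z by rewrite subrK.
    by rewrite memvD ?(sB _ Bxz) ?memvZ ?(subvP (addvSr _ _) z) ?memv_line.
  by case/negP: nBz; rewrite -z_sub (subvP (addvSr _ _)) ?memv_line.
have [p0|p0] := eqVneq p 0.
  by case: nsol; apply: solvable_of_weights xy xz _ xyz; rewrite yz p0 scale0r add0r.
exact: (sl2_triple_of_weights char2 a0 y0 p0 xy xz yz xyz).
Qed.

(** The maximal subalgebras [<[h]> + <[e]>] and [<[h]> + <[f]>] meet in [<[h]>], which contains no
    nonzero ideal since [lie e h] is [- 2 e]. *)
Lemma frattini_eq0_of_sl2_triple (e f h : L) :
  2%:R != 0 :> F ->
  (forall x y a, y != 0 -> a != 0 -> lie x y = a *: y ->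
     is_maximal_subalgebra (<[x]> + <[y]>)%VS fullv) ->
  sl2_triple e f h -> h != 0 -> frattini L = 0%VS.
Proof.
move=> char2 maxB tr h0; have [he hf ef] := tr.
have e0 : e != 0 by apply: contraNneq h0 => e0; rewrite -ef e0 lie0l.
have f0 : f != 0 by apply: contraNneq h0 => f0; rewrite -ef f0 lie0r.
have [idP inmax _] := frattiniP L.
have sPe := inmax _ (maxB h e _ e0 char2 he).
have hf' : lie h f = (- 2%:R) *: f by rewrite scaleNr.
have char2' : - 2%:R != 0 :> F by rewrite oppr_eq0.
have sPf := inmax _ (maxB h f _ f0 char2' hf').
have Ph v : v \in frattini L -> exists c, v = c *: h.
  move=> Pv; have /mem_line2P[c [d vE]] := subvP sPe _ Pv.
  have /mem_line2P[c' [d' vE']] := subvP sPf _ Pv.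
  have : comb3 e f h d (- d') (c - c') = 0.
    rewrite /comb3 scalerBl scaleNr addrACA [d *: e + _]addrC -vE -opprD.
    by rewrite [d' *: f + _]addrC -vE' subrr.
  by move=> /(sl2_triple_free char2 tr h0)[d0 _ _]; exists c; rewrite vE d0 scale0r addr0.
apply/eqP; rewrite -subv0; apply/subvP => v Pv; have [c vE] := Ph v Pv.
have [c' ev] := Ph _ (idP e v Pv).
have : comb3 e f h (- (c * 2%:R)) 0 (- c') = 0.
  have ev' : lie e v = - ((c * 2%:R) *: e).
    by rewrite vE linearZ /= (lieC e) he scalerN scalerA.
  by rewrite /comb3 scale0r addr0 !scaleNr -ev ev' subrr.
case/(sl2_triple_free char2 tr h0) => /eqP; rewrite oppr_eq0 mulf_eq0 (negPf char2) orbF.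
by move=> /eqP c0 _ _; rewrite vE c0 scale0r mem0v.
Qed.

Lemma frattini_eq0_of_nilpotent_2maximal :
  2%:R != 0 :> F -> ~ solvable L ->
  (forall S : {vspace L}, is_2maximal_subalgebra S -> nilpotent_subalgebra S) ->
  frattini L = 0%VS /\ lie_isomorphic (quot_lie (@frattini_ideal F L)) (sl2 F).
Proof.
move=> char2 nsol nil2.
have maxB x y a (y0 : y != 0) (a0 : a != 0) (xy : lie x y = a *: y) :=
  line2_maximal nil2 nsol y0 a0 xy.
have [//|x0 [y0 [a0 [_ _ y00 a00 x0y0]]]] :=
  @exists_eigenvector F L fullv _ (not_solvable_not_nilpotent nsol).
  by move=> ? ? _ _; apply: memvf.
have [||y [a [yn0 an0 xy nily]]] := @exists_nilpotent_eigenvector F L x0 char2.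
- by move=> y a; apply: maxB.
- by exists y0, a0.
have [e [f [h [tr h0 efh]]]] :=
  sl2_triple_of_nilpotent_eigenvector char2 nsol yn0 an0 xy (maxB _ _ _ yn0 an0 xy) nily.
have P0 : frattini L = 0%VS by apply: frattini_eq0_of_sl2_triple char2 maxB tr h0.
split=> //.
(* The kernel of [pi] is zero, so the triple passes to the quotient with [pi h] nonzero. *)
pose pi := quot_proj (@frattini_ideal F L).
have [he hf ef] := tr.
apply: (@lie_isomorphic_sl2 _ _ char2 (pi e) (pi f) (pi h)).
- by split; rewrite -quot_proj_lie ?he ?hf ?ef ?linearN ?linearZ.
- by rewrite quot_proj_eq0 P0 memv0.
apply/eqP; rewrite eqEsubv subvf /=; apply/subvP => u _.
have [v <-] := quot_proj_onto u.
have /comb3P[a1 [b [c ->]]] : v \in (<[e]> + <[f]> + <[h]>)%VS by rewrite efh memvf.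
by apply/comb3P; exists a1, b, c; rewrite /comb3 !linearD !linearZ.
Qed.

End NilpotentTwoMaximal.

Theorem theorem2p4 (F : closedFieldType) (L : lieAlgType F)
    (char_ne2 : 2%N \notin [pchar F]) (char_ne3 : 3%N \notin [pchar F])
    (nsolvL : ~ solvable L) :
  let all_2max_nilpotent :=
    forall S : {vspace L}, is_2maximal_subalgebra S -> nilpotent_subalgebra S in
  let sl2_quotient_acts_nilpotently :=
    lie_isomorphic (quot_lie (@frattini_ideal F L)) (sl2 F) /\
    acts_nilpotently (frattini L) in
  (all_2max_nilpotent <-> sl2_quotient_acts_nilpotently) /\
  (all_2max_nilpotent -> sl2_quotient_acts_nilpotently ->
   [pchar F] =i pred0 \/ restricted L ->
   frattini L = 0%VS).
Proof.
(* These names stand for the two [let]-bound propositions, not for assumptions. *)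
move=> nil2 sl2q.
have char2 : 2%:R != 0 :> F by apply: contra char_ne2 => char2; apply/andP.
split; last by move=> _ [iso nilP] _; apply: (frattini_eq0_of_sl2_quotient char2 iso nilP).1.
split=> [nil2L | [iso nilP]].
  have [P0 iso] := frattini_eq0_of_nilpotent_2maximal char2 nsolvL nil2L.
  by split=> // x; exists 0%N => v; rewrite P0 memv0 => /eqP.
move=> S; apply: dim3_2maximal_nilpotent.
exact: (frattini_eq0_of_sl2_quotient char2 iso nilP).2.
Qed.
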